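(* Let $(X,d)$ be a metric space of finite Nagata dimension. Then there exists $\lambda<\infty$ such that, for every scale $s\in (0,\infty)$ and every maximal $s$-separated subset $A \subseteq X$, the free space $\mathrm{LF}(X)$ is isomorphic to a complemented subspace of the $\ell^1$-sum $\left(\bigoplus^1_{a\in A}\mathrm{LF}(B_{\lambda s}(a))\right) \oplus \mathrm{LF}(A)$.
   Context: A metric space $X$ has Nagata dimension $n\in\mathbb{N}=\{0,1,2,\dots\}$ with constant $\gamma<\infty$ if for every $t>0$ there is a cover $\mathcal{C}$ of $X$ such that $\mathrm{diam}(C)\le\gamma t$ for all $C\in\mathcal{C}$ and every $E\subseteq X$ with $\mathrm{diam}(E)\le t$ meets at most $n+1$ members of $\mathcal{C}$; it has finite Nagata dimension if such $n,\gamma$ exist. A subset $A\subseteq X$ is $s$-separated if $d(a,b)>s$ for all distinct $a,b\in A$, and maximal $s$-separated if it is not properly contained in another $s$-separated subset. $B_r(a)$ is the closed ball $\{y\in X:d(a,y)\le r\}$. For a metric space $X$ with a chosen basepoint, $\mathrm{Lip}_0(X)$ is the Banach space of real Lipschitz functions vanishing at the basepoint, normed by the Lipschitz constant; the (Lipschitz) free space $\mathrm{LF}(X)$ is the closed linear span in $\mathrm{Lip}_0(X)^*$ of the evaluation functionals $\delta_x$, $x\in X$ (its isometry type does not depend on the basepoint). $\bigoplus^1_{a\in A}V_a$ is the Banach space of families $(v_a)_{a\in A}$, $v_a\in V_a$, with norm $\sum_a\|v_a\|<\infty$. A subspace $U$ of a Banach space $W$ is complemented if there is a bounded linear $R:W\to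 U$ restricting to the identity on $U$. *)

(* Defs.v *)
From HB Require Import structures.
From mathcomp Require Import all_boot all_order all_algebra.
From mathcomp Require Import all_classical all_reals.
From mathcomp Require Import ereal topology normedtype sequences esum.

Set Implicit Arguments.
Unset Strict Implicit.
Unset Printing Implicit Defensive.
Import Order.TTheory GRing.Theory Num.Theory.
Import numFieldNormedType.Exports.

Local Open Scope classical_set_scope.
Local Open Scope ring_scope.

Section subset_metric.
Context {R : realType} {X : metricType R} (A : set X).

Definition set_mdist (x y : A) : R := mdist (\val x) (\val y).

Let set_mdist_ge0 x y : 0 <= set_mdist x y.
Proof. exact: mdist_ge0. Qed.

Let set_mdist_positivity x y : set_mdist x y = 0 -> x = y.
Proof. by move=> /mdist_positivity /val_inj. Qed.

Let set_ballE (x : A) d : ball x d = [set y | set_mdist x y < d].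
Proof.
rewrite /ball/= /initial_ball ballEmdist.
by apply/seteqP; split=> y.
Qed.

HB.instance Definition _ := @PseudoMetric_isMetric.Build R A
  set_mdist set_mdist_ge0 set_mdist_positivity set_ballE.

End subset_metric.

Section metric_notions.
Context {R : realType} {X : metricType R}.
Implicit Types (A B C E : set X) (r s t : R).

(* [-oo] for the empty set; [diam E <= r] then says that all distances within
   [E] are at most [r]. *)
Definition diam E : \bar R := ereal_sup [set (mdist x y)%:E | x in E & y in E].

(* The library's [closed_ball] is the closure of the open ball, which may be
   smaller than the set of points at distance at most [r]. *)
Definition cball (a : X) r : set X := [set y | mdist a y <= r].

Definition s_separated s A :=
  forall a b, A a -> A b -> a <> b -> s < mdist a b.

Definition maximal_separated s A :=
  s_separated s A /\ ~ exists2 B, s_separated s B & A `<` B.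

End metric_notions.

Section nagata.
Context {R : realType} (X : metricType R).

Definition nagata_dim (n : nat) (gamma : R) :=
  forall t : R, 0 < t -> exists C : set (set X),
    [/\ \bigcup_(c in C) c = setT,
        forall c, C c -> (diam c <= (gamma * t)%:E)%E
      & forall E : set X, (diam E <= t%:E)%E ->
          ([set c | C c /\ c `&` E !=set0] #<= `I_n.+1)%card].

Definition finite_nagata_dim := exists n gamma, nagata_dim n gamma.

End nagata.

Definition subspace_of {R : realType} {V : lmodType R} (U : submodClosed V) :=
  {v : V | v \in U}.

Section subspace_lmod.
Context {R : realType} {V : lmodType R} (U : submodClosed V).

HB.instance Definition _ := [isSub of subspace_of U for @sval _ _].
HB.instance Definition _ := [Choice of subspace_of U by <:].
HB.instance Definition _ := [SubChoice_isSubLmodule of subspace_of U by <:].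

End subspace_lmod.

Section subspace_normed.
Context {R : realType} {V : normedModType R} (U : submodClosed V).

Definition subspace_norm (u : subspace_of U) : R := `|\val u|.

Let subspace_normD u v :
  subspace_norm (u + v) <= subspace_norm u + subspace_norm v.
Proof. by rewrite /subspace_norm raddfD ler_normD. Qed.

Let subspace_normZ (l : R) u : subspace_norm (l *: u) = `|l| * subspace_norm u.
Proof. by rewrite /subspace_norm linearZ normrZ. Qed.

Let subspace_norm0 u : subspace_norm u = 0 -> u = 0.
Proof. by move/normr0_eq0 => u0; apply: val_inj; rewrite u0 raddf0. Qed.

HB.instance Definition _ := @Lmodule_isNormed.Build R (subspace_of U)
  subspace_norm subspace_normD subspace_normZ subspace_norm0.

End subspace_normed.

(* The least constant [L >= 0] satisfying [P]: for the conditions used below the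
   set is nonempty and the infimum is attained, see [best_constP]. *)
Definition best_const {R : realType} (P : R -> Prop) : R :=
  inf [set L | 0 <= L /\ P L].

Section best_const_theory.
Context {R : realType}.
Implicit Types (P : R -> Prop) (L M : R).

Let lb0 P : lbound [set L | 0 <= L /\ P L] 0.
Proof. by move=> L []. Qed.

Lemma best_const_ge0 P : 0 <= best_const P.
Proof.
have [E|ne] := eqVneq [set L | 0 <= L /\ P L] set0.
  by rewrite /best_const E inf0.
by rewrite /best_const; apply: lb_le_inf => //; exact/set0P.
Qed.

Lemma best_const_le P L : 0 <= L -> P L -> best_const P <= L.
Proof. by move=> L0 PL; apply: ge_inf => //; exists 0; exact: lb0. Qed.

Lemma best_constP P : (exists2 L, 0 <= L & P L) ->
  (forall L, (forall e, 0 < e -> exists2 M, M < L + e & P M) -> P L) ->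
  P (best_const P).
Proof.
move=> [L L0 PL]; apply=> e e0.
have [|M [M0 PM] Me] := @inf_adherent R [set L | 0 <= L /\ P L] e e0.
  by split; [exists L|exists 0; exact: lb0].
by exists M.
Qed.

Lemma le_mul_inf (a b L : R) : 0 <= b ->
  (forall e, 0 < e -> exists2 M, M < L + e & a <= M * b) -> a <= L * b.
Proof.
move=> b0 H; apply/ler_addgt0Pr => e e0.
have [M ML aM] := H (e / (b + 1)) ltac:(by rewrite divr_gt0// ltr_wpDl).
apply: (le_trans aM); apply: (le_trans (ler_wpM2r b0 (ltW ML))).
rewrite mulrDl lerD2l -mulrA ler_piMr// ?(ltW e0)//.
by rewrite mulrC ler_pdivrMr ?ltr_wpDl// mul1r lerDl.
Qed.

End best_const_theory.

Section bounded_operators.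
Context {R : realType} {V W : normedModType R}.
Implicit Types (f : V -> W) (M : R).

Definition op_bound f M := forall v, `|f v| <= M * `|v|.

Definition bounded_linear f := linear f /\ exists M, op_bound f M.

Definition bounded_linear_pred : {pred V -> W} := fun f => `[< bounded_linear f >].

Let bounded_linear_submod : GRing.submod_closed bounded_linear_pred.
Proof.
split.
  apply/asboolP; split=> [a u v|]; first by rewrite scaler0 addr0.
  by exists 0 => v; rewrite normr0 mul0r.
move=> a f g /asboolP[lf [M fM]] /asboolP[lg [N gN]]; apply/asboolP; split.
  move=> b u v; rewrite !fctE/= lf lg !scalerDr !scalerA (mulrC a b).
  by rewrite addrACA.
exists (`|a| * M + N) => v; rewrite !fctE/=.
by rewrite (le_trans (ler_normD _ _))// normrZ mulrDl lerD// -mulrA ler_wpM2l.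
Qed.

HB.instance Definition _ :=
  GRing.isSubmodClosed.Build R (V -> W) bounded_linear_pred bounded_linear_submod.

End bounded_operators.

Definition operators {R : realType} (V W : normedModType R) :=
  {f : V -> W | f \in bounded_linear_pred}.

Section operators_normed.
Context {R : realType} (V W : normedModType R).

HB.instance Definition _ := [isSub of operators V W for @sval _ _].
HB.instance Definition _ := [Choice of operators V W by <:].
HB.instance Definition _ := [SubChoice_isSubLmodule of operators V W by <:].

Implicit Types (f g : operators V W) (M : R).

Definition op_norm f : R := best_const (op_bound (\val f)).

Lemma op_normP f : op_bound (\val f) (op_norm f).
Proof.
apply: best_constP => [|L H v].
  case/asboolP: (valP f) => _ [M fM]; exists `|M| => // v.
  by apply: (le_trans (fM v)); rewrite ler_wpM2r// ler_norm.
by apply: le_mul_inf => // e /H[M ML fM]; exists M.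
Qed.

Lemma op_norm_le f M : 0 <= M -> op_bound (\val f) M -> op_norm f <= M.
Proof. exact: best_const_le. Qed.

Let op_normD f g : op_norm (f + g) <= op_norm f + op_norm g.
Proof.
apply: op_norm_le => [|v]; first by rewrite addr_ge0// best_const_ge0.
by rewrite raddfD/= mulrDl (le_trans (ler_normD _ _))// lerD// op_normP.
Qed.

Let op_normZ_le (l : R) f : op_norm (l *: f) <= `|l| * op_norm f.
Proof.
apply: op_norm_le => [|v]; first by rewrite mulr_ge0// best_const_ge0.
by rewrite linearZ/= normrZ -mulrA ler_wpM2l// op_normP.
Qed.

Let op_norm0 f : op_norm f = 0 -> f = 0.
Proof.
move=> f0; apply: val_inj; rewrite raddf0; apply/funext => v.
by apply/normr0_eq0/le_anti; rewrite normr_ge0 andbT -(mul0r `|v|) -f0 op_normP.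
Qed.

Let op_normZ (l : R) f : op_norm (l *: f) = `|l| * op_norm f.
Proof.
apply/le_anti; rewrite op_normZ_le/=.
have [->|l0] := eqVneq l 0; first by rewrite normr0 mul0r best_const_ge0.
rewrite -ler_pdivlMl ?normr_gt0// -normfV.
by apply: le_trans (op_normZ_le _ _); rewrite scalerA mulVf// scale1r.
Qed.

HB.instance Definition _ := @Lmodule_isNormed.Build R (operators V W)
  op_norm op_normD op_normZ op_norm0.

End operators_normed.

Definition dual {R : realType} (V : normedModType R) := operators V R^o.

Section banach_notions.
Context {R : realType}.

Definition isomorphic (V W : normedModType R) :=
  exists (T : V -> W) (S : W -> V),
    [/\ bounded_linear T, bounded_linear S, cancel T S & cancel S T].

Definition complemented {W : normedModType R} (U : submodClosed W) :=
  exists P : W -> subspace_of U,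
    bounded_linear P /\ forall u : subspace_of U, P (\val u) = u.

End banach_notions.

Section closed_span.
Context {R : realType} {V : normedModType R}.
Implicit Type S : set V.

Definition linear_span S : set V :=
  [set v | exists n (c : 'I_n -> R) (s : 'I_n -> V),
     (forall i, S (s i)) /\ v = \sum_(i < n) c i *: s i].

Definition closed_span_pred S : {pred V} :=
  fun v => `[< closure (linear_span S) v >].

Let linear_span0 S : linear_span S 0.
Proof.
exists 0%N, (fun=> 0), (fun=> 0); split; first by case.
by rewrite big_ord0.
Qed.

Let linear_spanP S a u v :
  linear_span S u -> linear_span S v -> linear_span S (a *: u + v).
Proof.
move=> [n [c [s [Ss ->]]]] [m [d [t [St ->]]]].
exists (n + m)%N,
  (fun i => match fintype.split i with inl j => a * c j | inr k => d k end),
  (fun i => match fintype.split i with inl j => s j | inr k => t k end); split.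
  by move=> i; case: (fintype.split i).
rewrite big_split_ord/= scaler_sumr; congr (_ + _); apply: eq_bigr => i _.
  by rewrite -[lshift _ _]/(unsplit (inl i)) unsplitK scalerA.
by rewrite -[rshift _ _]/(unsplit (inr i)) unsplitK.
Qed.

Let closureP (A : set V) v :
  closure A v <-> forall e : R, 0 < e -> exists2 w, A w & `|v - w| < e.
Proof.
split=> [cl e e0|H B /nbhs_ballP[e e0 eB]].
  have [w [Aw]] := cl _ (nbhsx_ballx v _ e0).
  by rewrite -ball_normE => we; exists w.
have [w Aw we] := H _ e0; exists w; split => //.
by apply: eB; rewrite -ball_normE.
Qed.

Let closed_span_submod S : GRing.submod_closed (closed_span_pred S).
Proof.
split; first by apply/asboolP/closureP => e e0; exists 0; rewrite ?subrr ?normr0.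
move=> a u v /asboolP/closureP cu /asboolP/closureP cv; apply/asboolP/closureP.
move=> e e0; have a0 : 0 < `|a| + 1 by rewrite ltr_wpDl.
have [u' Su uu'] := cu (e / 2 / (`|a| + 1)) ltac:(by rewrite !divr_gt0).
have [v' Sv vv'] := cv (e / 2) ltac:(by rewrite divr_gt0).
exists (a *: u' + v'); first exact: linear_spanP.
rewrite opprD addrACA -scalerBr (le_lt_trans (ler_normD _ _))//.
rewrite [e]splitr ler_ltD// normrZ.
rewrite ltr_pdivlMr// in uu'; apply: le_trans (ltW uu').
by rewrite mulrC ler_wpM2l// lerDl.
Qed.

HB.instance Definition _ S := GRing.isSubmodClosed.Build R V
  (closed_span_pred S) (closed_span_submod S).

End closed_span.

Section lip0.
Context {R : realType} {X : metricType R}.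
Implicit Types (f : X -> R) (L : R).

Definition lip_bound f L := forall x y, `|f x - f y| <= L * mdist x y.

Definition lip0_pred (x0 : X) : {pred X -> R^o} :=
  fun f => `[< f x0 = 0 /\ exists L, lip_bound f L >].

Let lip0_submod x0 : GRing.submod_closed (lip0_pred x0).
Proof.
split.
  apply/asboolP; split=> //; exists 0 => x y.
  by rewrite [X in `|X|]subrr normr0 mul0r.
move=> a f g /asboolP[f0 [L fL]] /asboolP[g0 [M gM]]; apply/asboolP.
split; first by rewrite !fctE f0 g0 scaler0 addr0.
exists (`|a| * L + M) => x y; rewrite !fctE/= opprD addrACA -scalerBr.
rewrite (le_trans (ler_normD _ _))// mulrDl lerD//.
by rewrite normrZ -mulrA ler_wpM2l.
Qed.

HB.instance Definition _ x0 := GRing.isSubmodClosed.Build R (X -> R^o)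
  (lip0_pred x0) (lip0_submod x0).

End lip0.

Definition lip0 {R : realType} (X : metricType R) (x0 : X) :=
  {f : X -> R^o | f \in lip0_pred x0}.

Section lip0_normed.
Context {R : realType} (X : metricType R) (x0 : X).

HB.instance Definition _ := [isSub of lip0 x0 for @sval _ _].
HB.instance Definition _ := [Choice of lip0 x0 by <:].
HB.instance Definition _ := [SubChoice_isSubLmodule of lip0 x0 by <:].

Implicit Types (f g : lip0 x0) (L : R).

Definition lip_norm f : R := best_const (lip_bound (\val f)).

Lemma lip_normP f : lip_bound (\val f) (lip_norm f).
Proof.
apply: best_constP => [|L H x y].
  case/asboolP: (valP f) => _ [L fL]; exists `|L| => // x y.
  by apply: (le_trans (fL x y)); rewrite ler_wpM2r ?mdist_ge0// ler_norm.
by apply: le_mul_inf; rewrite ?mdist_ge0// => e /H[M ML fM]; exists M.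
Qed.

Lemma lip_norm_le f L : 0 <= L -> lip_bound (\val f) L -> lip_norm f <= L.
Proof. exact: best_const_le. Qed.

Lemma lip0_base f : (\val f) x0 = 0.
Proof. by case/asboolP: (valP f). Qed.

Let lip_normD f g : lip_norm (f + g) <= lip_norm f + lip_norm g.
Proof.
apply: lip_norm_le => [|x y]; first by rewrite addr_ge0// best_const_ge0.
rewrite raddfD !fctE/= opprD addrACA mulrDl (le_trans (ler_normD _ _))//.
by rewrite lerD// lip_normP.
Qed.

Let lip_normZ_le (l : R) f : lip_norm (l *: f) <= `|l| * lip_norm f.
Proof.
apply: lip_norm_le => [|x y]; first by rewrite mulr_ge0// best_const_ge0.
have E z : (\val (l *: f)) z = l *: (\val f) z by rewrite linearZ.
by rewrite !E -scalerBr normrZ -mulrA ler_wpM2l// lip_normP.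
Qed.

Let lip_norm0 f : lip_norm f = 0 -> f = 0.
Proof.
move=> f0; apply: val_inj; rewrite raddf0; apply/funext => x.
apply/normr0_eq0/le_anti; rewrite normr_ge0 andbT.
have := lip_normP f x x0; rewrite f0 mul0r lip0_base.
by rewrite subr0.
Qed.

Let lip_normZ (l : R) f : lip_norm (l *: f) = `|l| * lip_norm f.
Proof.
apply/le_anti; rewrite lip_normZ_le/=.
have [->|l0] := eqVneq l 0; first by rewrite normr0 mul0r best_const_ge0.
rewrite -ler_pdivlMl ?normr_gt0// -normfV.
by apply: le_trans (lip_normZ_le _ _); rewrite scalerA mulVf// scale1r.
Qed.

HB.instance Definition _ := @Lmodule_isNormed.Build R (lip0 x0)
  lip_norm lip_normD lip_normZ lip_norm0.

Let eval_bounded (x : X) :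
  (fun f : lip0 x0 => (\val f) x : R^o) \in bounded_linear_pred.
Proof.
apply/asboolP; split=> [a f g|].
  by have /(congr1 (@^~ x)) := linearP (\val : lip0 x0 -> X -> R^o) a f g.
exists (mdist x x0) => f; have := lip_normP f x x0.
by rewrite lip0_base subr0 mulrC.
Qed.

Definition delta (x : X) : dual (lip0 x0) :=
  exist (fun F => F \in bounded_linear_pred) (fun f => (\val f) x)
    (eval_bounded x).

Definition LF : normedModType R :=
  subspace_of (closed_span_pred (range delta)).

End lip0_normed.

Arguments LF {R} X x0.

Definition families {R : realType} {I : choiceType} (V : I -> normedModType R) :=
  forall i, V i.

Section families_lmod.
Context {R : realType} {I : choiceType} (V : I -> normedModType R).
Implicit Types (u v w : families V) (a b : R).

HB.instance Definition _ := gen_eqMixin (families V).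
HB.instance Definition _ := gen_choiceMixin (families V).

Let zero : families V := fun=> 0.
Let opp v : families V := fun i => - v i.
Let add u v : families V := fun i => u i + v i.
Let scale a v : families V := fun i => a *: v i.

Let addA : associative add.
Proof. by move=> u v w; apply: functional_extensionality_dep => i; exact: addrA. Qed.
Let addC : commutative add.
Proof. by move=> u v; apply: functional_extensionality_dep => i; exact: addrC. Qed.
Let add0 : left_id zero add.
Proof. by move=> u; apply: functional_extensionality_dep => i; exact: add0r. Qed.
Let addN : left_inverse zero opp add.
Proof. by move=> u; apply: functional_extensionality_dep => i; exact: addNr. Qed.

HB.instance Definition _ :=
  GRing.isZmodule.Build (families V) addA addC add0 addN.

Let scaleA a b v : scale a (scale b v) = scale (a * b) v.
Proof. by apply: functional_extensionality_dep => i; exact: scalerA. Qed.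
Let scale1 : left_id 1 scale.
Proof. by move=> v; apply: functional_extensionality_dep => i; exact: scale1r. Qed.
Let scaleDr : right_distributive scale +%R.
Proof. by move=> a u v; apply: functional_extensionality_dep => i; exact: scalerDr. Qed.
Let scaleDl v : {morph scale^~ v : a b / a + b}.
Proof. by move=> a b; apply: functional_extensionality_dep => i; exact: scalerDl. Qed.

HB.instance Definition _ :=
  GRing.Zmodule_isLmodule.Build R (families V) scaleA scale1 scaleDr scaleDl.

Definition sum_norms v : \bar R := \esum_(i in [set: I]) (`|v i|)%:E.

Definition l1_pred : {pred families V} := fun v => (sum_norms v < +oo)%E.

Lemma sum_norms_ge0 v : (0 <= sum_norms v)%E.
Proof. by apply: esum_ge0 => i _; rewrite lee_fin. Qed.

Lemma sum_normsD u v : (sum_norms (u + v)%R <= sum_norms u + sum_norms v)%E.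
Proof.
rewrite /sum_norms -esumD; [|by move=> *; rewrite lee_fin..].
by apply: le_esum => i _; rewrite -EFinD lee_fin ler_normD.
Qed.

Lemma sum_normsZ_le a v : (sum_norms (a *: v)%R <= `|a|%:E * sum_norms v)%E.
Proof.
apply: ge_ereal_sup => _ [F [finF _] <-].
rewrite (_ : (\sum_(i \in F) _)%E = (`|a|%:E * \sum_(i \in F) (`|v i|)%:E)%E).
  by rewrite lee_wpmul2l ?lee_fin//; apply: ereal_sup_ubound; exists F.
rewrite ge0_mule_fsumr => [|i]; last by rewrite lee_fin.
by apply: eq_fsbigr => i _; rewrite -EFinM -normrZ.
Qed.

Let l1_submod : GRing.submod_closed l1_pred.
Proof.
split; first by rewrite unfold_in /sum_norms esum1// => i _; rewrite normr0.
move=> a u v; rewrite !unfold_in => lu lv.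
rewrite (le_lt_trans (sum_normsD _ _))// lte_add_pinfty//.
by rewrite (le_lt_trans (sum_normsZ_le _ _))// lte_mul_pinfty ?lee_fin.
Qed.

HB.instance Definition _ :=
  GRing.isSubmodClosed.Build R (families V) l1_pred l1_submod.

End families_lmod.

Arguments l1_pred {R I} V.

Definition l1_sum {R : realType} {I : choiceType} (V : I -> normedModType R) :=
  {v : families V | v \in l1_pred V}.

Section l1_normed.
Context {R : realType} {I : choiceType} (V : I -> normedModType R).

HB.instance Definition _ := [isSub of l1_sum V for @sval _ _].
HB.instance Definition _ := [Choice of l1_sum V by <:].
HB.instance Definition _ := [SubChoice_isSubLmodule of l1_sum V by <:].

Implicit Types (u v : l1_sum V).

Definition l1_norm v : R := fine (sum_norms (\val v)).

Lemma l1_normE v : (l1_norm v)%:E = sum_norms (\val v).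
Proof.
rewrite fineK// ge0_fin_numE ?sum_norms_ge0//.
by have := valP v; rewrite unfold_in.
Qed.

Let l1_normD u v : l1_norm (u + v) <= l1_norm u + l1_norm v.
Proof. by rewrite -lee_fin EFinD !l1_normE raddfD sum_normsD. Qed.

Let l1_normZ_le (a : R) v : l1_norm (a *: v) <= `|a| * l1_norm v.
Proof. by rewrite -lee_fin EFinM !l1_normE linearZ sum_normsZ_le. Qed.

Let l1_normZ (a : R) v : l1_norm (a *: v) = `|a| * l1_norm v.
Proof.
apply/le_anti; rewrite l1_normZ_le/=.
have [->|a0] := eqVneq a 0.
  by rewrite normr0 mul0r -lee_fin l1_normE sum_norms_ge0.
rewrite -ler_pdivlMl ?normr_gt0// -normfV.
by apply: le_trans (l1_normZ_le _ _); rewrite scalerA mulVf// scale1r.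
Qed.

Let l1_norm0 v : l1_norm v = 0 -> v = 0.
Proof.
move=> v0; apply: val_inj; rewrite raddf0.
apply: functional_extensionality_dep => i.
apply/normr0_eq0/le_anti; rewrite normr_ge0 andbT.
rewrite -lee_fin -v0 l1_normE; apply: ereal_sup_ubound.
by exists [set i]; [split; [exact: finite_set1|]|rewrite fsbig_set1].
Qed.

HB.instance Definition _ := @Lmodule_isNormed.Build R (l1_sum V)
  l1_norm l1_normD l1_normZ l1_norm0.

End l1_normed.

(* The l^1-sum of two spaces, as opposed to the library's product [V * W], whose
   norm is the maximum. *)
Definition l1_pair {R : realType} (V W : normedModType R) : normedModType R :=
  l1_sum (fun b : bool => if b then V else W).

(* Main.v *)
Require Import Defs.
From HB Require Import structures.
From mathcomp Require Import all_boot all_order all_algebra.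
From mathcomp Require Import all_classical all_reals.
From mathcomp Require Import ereal topology normedtype sequences esum.
From mathcomp Require Import ring lra.

Import Order.TTheory GRing.Theory Num.Theory.
Import numFieldNormedType.Exports.

(** Write [ev x] for the evaluation at [x], a point of the free space. A
    partition of unity [phi_a], indexed by [a] in [A], with [phi_a] supported in
    the ball of radius [lambda * s] around [a], splits every evaluation as
      ev x = sum_a phi_a(x) (ev x - ev a) + sum_a phi_a(x) ev a.
    The [a]-th term of the first sum lives in the free space of the ball around
    [a], the second sum lives in [LF A]. If both depend on [x] in a Lipschitz
    way, then the universal property of free spaces turns this splitting into a
    bounded operator [J] from [LF X] to the l^1-sum. The inclusions of the balls
    and of [A] in [X] induce an operator [P] in the other direction, and
    [P \o J] is the identity, because it fixes the evaluations ([ev x0 = 0]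
    absorbs the constants) and these span a dense subspace. A space that is a
    retract of another one in this sense is isomorphic to a complemented
    subspace of it ([retract_complemented]).

    Finite Nagata dimension is what makes [phi] exist. A cover at scale [s]
    yields a map [rho] from [X] to [A] that moves points by at most a multiple
    of [s] and takes at most [n + 1] values on every ball of radius [s / 2]
    ([nagata_retraction]). Normalizing suitable bumps around the fibres of [rho]
    gives a partition of unity of multiplicity at most [n + 1] whose members are
    [O(1 / s)]-Lipschitz ([partition_of_unity]). Since [ev x - ev a] has norm
    [O(s)] on the support of [phi_a], the [s] cancels in the Lipschitz constant
    of [phi_a(x) (ev x - ev a)], and bounded multiplicity controls the sum over
    [a].

    Three further ideas keep the argument short.
    - By the extension theorem of McShane, the inclusion of a subset of [X]
      induces an isometric embedding of free spaces ([LF_inclusion]). All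
      Lipschitz estimates are therefore made in [LF X], for the maps
      [phi_a(x) (ev x - ev a)] alone: the estimate for the component in [LF A]
      follows, because up to a constant that component is [ev x] minus their sum.
    - The universal property is proved by duality: the extension of a Lipschitz
      map [k] is the adjoint of the operator that pulls functions back along
      [k]. The l^1-bound for a family of maps follows by testing each component
      against an almost norming function ([l1_lip_extension]).
    - Defining [P] requires sums over the possibly uncountable set [A]. They
      exist in every dual space ([dual_complete]), and hence in the closed
      subspace [LF X]. *)

Local Open Scope classical_set_scope.
Local Open Scope ring_scope.

Set Implicit Arguments.
Unset Strict Implicit.
Unset Printing Implicit Defensive.

(** * Bounded operators, retracts and closed spans *)

Section operators_theory.
Context {R : realType} {V W : normedModType R}.

(** The named projection to which the linear structure and the coercion to
    functions are attached. *)
Definition op_fun (T : operators V W) : V -> W := \val T.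

Lemma op_fun_linear (T : operators V W) : linear (op_fun T).
Proof. by case/asboolP: (valP T). Qed.

HB.instance Definition _ (T : operators V W) :=
  GRing.isLinear.Build R V W *:%R (op_fun T) (op_fun_linear T).

Lemma opP (T : operators V W) a u v :
  op_fun T (a *: u + v) = a *: op_fun T u + op_fun T v.
Proof. exact: op_fun_linear. Qed.

Lemma op0 (T : operators V W) : op_fun T 0 = 0.
Proof. exact: linear0. Qed.

Lemma opB (T : operators V W) u v : op_fun T (u - v) = op_fun T u - op_fun T v.
Proof. exact: linearB. Qed.

Lemma op_sum I (r : seq I) (T : operators V W) (F : I -> V) :
  op_fun T (\sum_(i <- r) F i) = \sum_(i <- r) op_fun T (F i).
Proof. exact: linear_sum. Qed.

Lemma opZ (T : operators V W) a v : op_fun T (a *: v) = a *: op_fun T v.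
Proof. exact: linearZ. Qed.

Lemma op_evalP a (S T : operators V W) v :
  op_fun (a *: S + T) v = a *: op_fun S v + op_fun T v.
Proof. by rewrite /op_fun linearP. Qed.

Lemma op_evalB (S T : operators V W) v :
  op_fun (S - T) v = op_fun S v - op_fun T v.
Proof. by rewrite -scaleN1r addrC op_evalP scaleN1r addrC. Qed.

Lemma op_eval0 v : op_fun (0 : operators V W) v = 0.
Proof. by rewrite -[X in op_fun X](subrr 0) op_evalB subrr. Qed.

Lemma op_eval_sum I (r : seq I) (P : pred I) (T : I -> operators V W) v :
  op_fun (\sum_(i <- r | P i) T i) v = \sum_(i <- r | P i) op_fun (T i) v.
Proof.
elim/big_rec2: _ => [|i x y _ <-]; first exact: op_eval0.
by rewrite -[T i]scale1r op_evalP !scale1r.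
Qed.

Lemma op_fun_bound (T : operators V W) v : `|op_fun T v| <= `|T| * `|v|.
Proof. exact: op_normP. Qed.

Definition mk_op (f : V -> W) (fP : bounded_linear f) : operators V W :=
  exist (fun f => f \in bounded_linear_pred) f (asboolT fP).

Lemma mk_opE (f : V -> W) (fP : bounded_linear f) : op_fun (mk_op fP) = f.
Proof. by []. Qed.

Lemma le_op_norm (T : operators V W) M :
  0 <= M -> (forall v, `|op_fun T v| <= M * `|v|) -> `|T| <= M.
Proof. exact: op_norm_le. Qed.

Lemma op_ext (S T : operators V W) : op_fun S =1 op_fun T -> S = T.
Proof. by move=> ST; apply: val_inj; apply/funext. Qed.

End operators_theory.
Coercion op_fun : operators >-> Funclass.

Section retract.
Context {R : realType} {V W : normedModType R}.
Variables (J : operators V W) (P : operators W V).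

Definition fixed_pred : {pred W} := fun w => J (P w) == w.

Let fixed_submod : GRing.submod_closed fixed_pred.
Proof.
split; first by rewrite unfold_in !op0.
move=> a u v; rewrite !unfold_in => /eqP Ju /eqP Jv.
by rewrite !opP Ju Jv.
Qed.

HB.instance Definition _ :=
  GRing.isSubmodClosed.Build R W fixed_pred fixed_submod.

(** The range of [J] is the fixed space of [J \o P], which is how the subspace is
    encoded: membership becomes an equation, and [J \o P] is the projection. *)
Lemma retract_complemented : cancel J P ->
  exists U : submodClosed W, complemented U /\ isomorphic V (subspace_of U).
Proof.
move=> JK; pose U : submodClosed W := fixed_pred; exists U.
have JU v : J v \in U by rewrite unfold_in JK.
pose T v : subspace_of U := exist (fun w => w \in U) _ (JU v).
have Tlin : linear T by move=> a u v; apply: val_inj; rewrite /= !opP.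
have TP w : w \in U -> J (P w) = w by rewrite unfold_in => /eqP.
split.
  exists (T \o P); split; last by move=> u; apply/val_inj/TP/valP.
  split; first by move=> a u v; rewrite /= opP Tlin.
  exists (`|J| * `|P|) => w.
  apply: (le_trans (op_fun_bound J (P w))).
  by rewrite -mulrA ler_wpM2l// op_fun_bound.
exists T, (P \o \val); split.
- by split=> //; exists `|J| => v; exact: (op_fun_bound J).
- split; first by move=> a u v; rewrite /= !opP.
  by exists `|P| => w; exact: (op_fun_bound P).
- exact: JK.
- by move=> w; apply/val_inj/TP/valP.
Qed.

End retract.

Section comp.
Context {R : realType} {V W Z : normedModType R}.

Lemma comp_op (S : operators W Z) (T : operators V W) :
  exists U : operators V Z, forall v, U v = S (T v).
Proof.
have lin : linear (S \o T) by move=> a u v; rewrite /= !opP.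
have bd : op_bound (S \o T) (`|S| * `|T|).
  move=> v; rewrite (le_trans (op_fun_bound _ _))// -mulrA ler_wpM2l//.
  exact: op_fun_bound.
by exists (mk_op (conj lin (ex_intro _ _ bd))).
Qed.

End comp.

Section closed_span_theory.
Context {R : realType}.

Lemma mem_closed_span {V : normedModType R} (S : set V) v :
  S v -> v \in closed_span_pred S.
Proof.
move=> Sv; apply/asboolP/subset_closure.
exists 1%N, (fun=> 1), (fun=> v); split=> //.
by rewrite big_ord1 scale1r.
Qed.

Lemma closed_span_approx {V : normedModType R} (S : set V) v :
  (forall e : R, 0 < e -> exists2 w, w \in closed_span_pred S & `|v - w| <= e) ->
  v \in closed_span_pred S.
Proof.
move=> H; apply/asboolP; apply: (@closed_closure V (linear_span S)).
move=> B /nbhs_ballP[e e0 eB].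
have [w /asboolP wS vw] := H (e / 2) ltac:(by rewrite divr_gt0).
exists w; split=> //; apply: eB; rewrite -ball_normE/=.
by rewrite (le_lt_trans vw)// ltr_pdivrMr// mulr2n mulrDr mulr1 ltrDl.
Qed.

Lemma closed_span_ind {V : normedModType R} (S : set V) (Q : V -> Prop) :
  (forall a u v, Q u -> Q v -> Q (a *: u + v)) ->
  (forall v, (forall e : R, 0 < e -> exists2 w, Q w & `|v - w| < e) -> Q v) ->
  Q 0 -> (forall v, S v -> Q v) ->
  forall v, v \in closed_span_pred S -> Q v.
Proof.
move=> Qlin Qcl Q0 QS v /asboolP clv; apply: Qcl => e e0.
have [w [[n [c [s [Ss ->]]]] we]] := clv _ (nbhsx_ballx v _ e0).
exists (\sum_(i < n) c i *: s i); last by move: we; rewrite -ball_normE.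
elim/big_ind: _ => // [x y Qx Qy|i _]; first by rewrite -(scale1r x); apply: Qlin.
by rewrite -[_ *: _]addr0; apply: Qlin => //; exact: QS.
Qed.

Context {V W : normedModType R}.

Lemma op_closed_span (T : operators V W) (S : set V) (S' : set W) :
  (forall v, S v -> T v \in closed_span_pred S') ->
  forall v, v \in closed_span_pred S -> T v \in closed_span_pred S'.
Proof.
move=> TS; apply: closed_span_ind => //.
- by move=> a u v Tu Tv; rewrite opP rpredD// rpredZ.
- move=> v H; apply: closed_span_approx => e e0.
  have T0 : 0 < `|T| + 1 by rewrite ltr_wpDl.
  have [w Tw vw] := H (e / (`|T| + 1)) ltac:(by rewrite divr_gt0).
  exists (T w) => //; rewrite -opB (le_trans (op_fun_bound _ _))//.
  have /ltW := vw; rewrite ler_pdivlMr// => ?.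
  have : 0 <= `|v - w| by [].
  nra.
- by rewrite op0 rpred0.
Qed.

(** Used for the adjoints below, which act on full dual spaces but have to be
    restricted to free spaces. *)
Lemma op_on_closed_span (A : operators V W) (S : set V) (S' : set W) :
  (forall v, S v -> A v \in closed_span_pred S') ->
  exists2 T : operators (subspace_of (closed_span_pred S))
                        (subspace_of (closed_span_pred S')),
    forall u, \val (T u) = A (\val u) & `|T| <= `|A|.
Proof.
move=> AS; pose C' := closed_span_pred S'.
pose T (u : subspace_of (closed_span_pred S)) : subspace_of C' :=
  exist (fun w => w \in C') (A (\val u)) (op_closed_span AS (valP u)).
have Tlin : linear T.
  move=> a u v; apply: val_inj; rewrite [RHS]linearP -[RHS](opP A).
  by rewrite -linearP.
have Tbd : op_bound T `|A| by move=> u; exact: op_fun_bound.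
by exists (mk_op (conj Tlin (ex_intro _ _ Tbd))) => //; exact: le_op_norm.
Qed.

(** The operators are defined on the closed span only, so the induction runs over
    ambient vectors together with a proof that they belong to the span. *)
Lemma eq_on_closed_span (S : set V)
    (T T' : operators (subspace_of (closed_span_pred S)) W) :
  (forall u, S (\val u) -> T u = T' u) -> forall u, T u = T' u.
Proof.
move=> TT' u; pose C := closed_span_pred S.
pose E (v : V) (vC : v \in C) : subspace_of C := exist (fun v => v \in C) v vC.
pose Q v := exists vC : v \in C, T (E v vC) = T' (E v vC).
suff [uC] : Q (\val u) by rewrite (_ : E _ uC = u)//; exact: val_inj.
move: (\val u) (valP u); apply: (@closed_span_ind _ S Q).
- move=> a v w [vC Tv] [wC Tw].
  have aC : a *: v + w \in C by rewrite rpredD// rpredZ.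
  exists aC; rewrite (_ : E _ aC = a *: E v vC + E w wC); last first.
    by apply: val_inj; rewrite linearP.
  by rewrite !opP Tv Tw.
- move=> v H; have vC : v \in C.
    apply: closed_span_approx => e e0; have [w [wC _] vw] := H e e0.
    by exists w => //; exact: ltW.
  exists vC; apply/eqP; rewrite -subr_eq0 -normr_le0; apply/ler_addgt0Pr => e e0.
  have M0 : 0 < `|T| + `|T'| + 1 by rewrite ltr_wpDl// addr_ge0.
  have [w [wC Tw] vw] := H (e / (`|T| + `|T'| + 1)) ltac:(by rewrite divr_gt0).
  set x := E v vC - E w wC.
  have {}vw : `|x| < e / (`|T| + `|T'| + 1).
    by rewrite (_ : `|x| = `|\val x|)// raddfB.
  rewrite add0r (_ : _ - _ = T x - T' x); last first.
    by rewrite !opB Tw opprB addrA subrK.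
  have := ler_normB (T x) (T' x).
  have := op_fun_bound T x; have := op_fun_bound T' x.
  have /ltW := vw; rewrite ler_pdivlMr//.
  have : 0 <= `|x| by [].
  nra.
- exists (rpred0 C); rewrite (_ : E _ _ = 0) ?op0//.
  by apply: val_inj; rewrite raddf0.
- move=> v Sv; have vC : v \in C by exact: mem_closed_span.
  by exists vC; exact: TT'.
Qed.

End closed_span_theory.
(** * Unconditional sums *)

Section unconditional_sums.
Context {R : realType} {I : choiceType}.

Lemma big_subseq {W : zmodType} (w : I -> W) (r r' : seq I) :
  uniq r -> uniq r' -> {subset r <= r'} ->
  \sum_(i <- r') w i = \sum_(i <- r) w i + \sum_(i <- r' | i \notin r) w i.
Proof.
move=> ur ur' rr'; rewrite (bigID (mem r))/=; congr (_ + _).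
rewrite -big_filter; apply: perm_big; apply: uniq_perm => //.
  exact: filter_uniq.
by move=> i; rewrite mem_filter; apply/andb_idr/rr'.
Qed.

(** Convergence along the finite subsets of [I] directed by inclusion. *)
Definition has_sum {W : normedModType R} (w : I -> W) (s : W) :=
  forall e : R, 0 < e -> exists r0 : seq I, forall r, uniq r ->
    {subset r0 <= r} -> `|\sum_(i <- r) w i - s| <= e.

Section has_sum_theory.
Context {W : normedModType R}.
Implicit Types (w : I -> W) (s : W).

Lemma has_sum_lin w w' s s' a : has_sum w s -> has_sum w' s' ->
  has_sum (fun i => a *: w i + w' i) (a *: s + s').
Proof.
move=> ws ws' e e0; have a0 : 0 < `|a| + 1 by rewrite ltr_wpDl.
have [r0 Hr0] := ws (e / 2 / (`|a| + 1)) ltac:(by rewrite !divr_gt0).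
have [r1 Hr1] := ws' (e / 2) ltac:(by rewrite divr_gt0).
exists (r0 ++ r1) => r ur sr.
have /Hr0 : {subset r0 <= r} by move=> i ir; apply: sr; rewrite mem_cat ir.
have /Hr1 : {subset r1 <= r} by move=> i ir; apply: sr; rewrite mem_cat ir orbT.
move=> /(_ ur) h1 /(_ ur); rewrite ler_pdivlMr// => h0.
rewrite big_split -scaler_sumr opprD addrACA -scalerBr/=.
apply: (le_trans (ler_normD _ _)); rewrite [e]splitr lerD// normrZ.
have : 0 <= `|\sum_(i <- r) w i - s| by [].
nra.
Qed.

Lemma has_sum_dist w s s' (c : R) : has_sum w s ->
  (forall r0 : seq I, exists r : seq I, [/\ uniq r, {subset r0 <= r} &
     `|\sum_(i <- r) w i - s'| <= c]) ->
  `|s - s'| <= c.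
Proof.
move=> ws H; apply/ler_addgt0Pr => e e0.
have [r0 Hr0] := ws e e0; have [r [ur sr ?]] := H r0.
have -> : s - s' = (\sum_(i <- r) w i - s') - (\sum_(i <- r) w i - s).
  by rewrite opprB [RHS]addrC subrKA.
by rewrite (le_trans (ler_normB _ _))// lerD// Hr0.
Qed.

Lemma has_sum_unique w s s' : has_sum w s -> has_sum w s' -> s = s'.
Proof.
move=> ws ws'; apply/eqP; rewrite -subr_eq0 -normr_le0; apply/ler_addgt0Pr => e e0.
rewrite add0r; apply: (has_sum_dist ws) => r0; have [r1 Hr1] := ws' e e0.
exists (undup (r0 ++ r1)); split; rewrite ?undup_uniq//.
  by move=> i ir; rewrite mem_undup mem_cat ir.
by apply: Hr1; rewrite ?undup_uniq// => i ir; rewrite mem_undup mem_cat ir orbT.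
Qed.

Lemma has_sum_bound w s (c : R) : has_sum w s ->
  (forall r, uniq r -> `|\sum_(i <- r) w i| <= c) -> `|s| <= c.
Proof.
move=> ws H; rewrite -[s]subr0; apply: (has_sum_dist ws) => r0.
exists (undup r0); rewrite subr0; split; [exact: undup_uniq| |exact/H/undup_uniq].
by move=> i; rewrite mem_undup.
Qed.

Lemma has_sum_finite w r : uniq r -> (forall i, i \notin r -> w i = 0) ->
  has_sum w (\sum_(i <- r) w i).
Proof.
move=> ur w0 e e0; exists r => r' ur' rr'.
rewrite (big_subseq _ ur ur' rr') [X in _ + X - _]big1; last by move=> i /w0.
by rewrite addr0 subrr normr0 ltW.
Qed.

End has_sum_theory.

Lemma ge0_has_sum (u : I -> R^o) (c : R) : (forall i, 0 <= (u i : R)) ->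
  (forall r, uniq r -> \sum_(i <- r) (u i : R) <= c) -> exists s, has_sum u s.
Proof.
move=> u0 uc; pose S : set R := [set \sum_(i <- r) (u i : R) | r in [set r | uniq r]].
have ubS : has_ubound S by exists c => _ [r ur <-]; exact: uc.
have hS : has_sup S by split=> //; exists 0; exists [::] => //; rewrite big_nil.
exists (sup S) => e e0; have [_ [r0 /= ur0 <-] Hr0] := sup_adherent e0 hS.
exists r0 => r ur r0r; rewrite distrC ger0_norm; last first.
  by rewrite subr_ge0; apply: ub_le_sup => //; exists r.
rewrite (big_subseq _ ur0 ur r0r).
have : 0 <= \sum_(i <- r | i \notin r0) (u i : R) by exact: sumr_ge0.
by move: Hr0; lra.
Qed.

(** A real family is the difference of the nonnegative families [u + |u|] and
    [|u|], and those are summed by suprema. *)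
Lemma abs_has_sum (u : I -> R^o) (c : R) :
  (forall r, uniq r -> \sum_(i <- r) `|u i| <= c) -> exists s, has_sum u s.
Proof.
move=> uc.
have [s sP] : exists s, has_sum (fun i => `|u i| : R^o) s.
  exact: (@ge0_has_sum _ c).
have [t tP] : exists t, has_sum (fun i => u i + `|u i| : R^o) t.
  apply: (@ge0_has_sum _ (c + c)) => [i|r ur].
    by rewrite -lerBlDr sub0r lerNl (le_trans (ler_norm _))// normrN.
  rewrite big_split/= lerD ?uc//; apply: le_trans (uc _ ur).
  by apply: ler_sum => i _; exact: ler_norm.
exists ((-1) *: s + t); have := has_sum_lin (-1) sP tP.
by congr has_sum; apply/funext => i; rewrite scaleN1r addrC addrK.
Qed.

(** Banach completeness, in the form suited to unconditional sums. *)
Definition summable_complete (W : normedModType R) :=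
  forall (w : I -> W) (c : R),
    (forall r, uniq r -> \sum_(i <- r) `|w i| <= c) -> exists s, has_sum w s.

(** The sum is taken pointwise. It converges in norm because, beyond a finite set
    [r0] that nearly exhausts the total norm, the norms of the remaining
    functionals add up to less than [e]. *)
Lemma dual_complete (Y : normedModType R) : summable_complete (dual Y).
Proof.
move=> w c wc.
have wf r f : \sum_(i <- r) `|op_fun (w i) f| <= (\sum_(i <- r) `|w i|) * `|f|.
  rewrite mulr_suml; apply: ler_sum => i _; exact: op_fun_bound.
have /choice[s sP] : forall f : Y, exists s, has_sum (fun i => op_fun (w i) f : R^o) s.
  move=> f; apply: (@abs_has_sum _ (c * `|f|)) => r ur.
  by rewrite (le_trans (wf _ _))// ler_wpM2r// wc.
have slin : linear (s : Y -> R^o).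
  move=> a f g; apply: (has_sum_unique (sP _)).
  have := has_sum_lin a (sP f) (sP g).
  by congr has_sum; apply/funext => i; rewrite opP.
have sbd f : `|s f| <= c * `|f|.
  apply: (has_sum_bound (sP f)) => r ur; rewrite (le_trans (ler_norm_sum _ _ _))//.
  by rewrite (le_trans (wf _ _))// ler_wpM2r// wc.
exists (mk_op (conj slin (ex_intro _ c sbd))) => e e0.
pose S : set R := [set \sum_(i <- r) `|w i| | r in [set r | uniq r]].
have ubS : has_ubound S by exists c => _ [r ur <-]; exact: wc.
have hS : has_sup S by split=> //; exists 0; exists [::] => //; rewrite big_nil.
have [_ [r0 /= ur0 <-] Hr0] := sup_adherent e0 hS.
exists r0 => r ur r0r; apply: le_op_norm; first exact: ltW.
move=> f; rewrite -normrN.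
have -> : - op_fun (\sum_(i <- r) w i - mk_op (conj slin (ex_intro _ c sbd))) f
   = s f - \sum_(i <- r) op_fun (w i) f.
  by rewrite op_evalB op_eval_sum opprB.
apply: (has_sum_dist (sP f)) => r1; exists (undup (r1 ++ r)).
have ur2 := undup_uniq (r1 ++ r).
have rr2 : {subset r <= undup (r1 ++ r)}.
  by move=> i ir; rewrite mem_undup mem_cat ir orbT.
split=> //; first by move=> i ir; rewrite mem_undup mem_cat ir.
rewrite (big_subseq _ ur ur2 rr2) [X in `|X|]addrAC subrr add0r.
rewrite (le_trans (ler_norm_sum _ _ _))//.
apply: (@le_trans _ _ ((\sum_(i <- undup (r1 ++ r) | i \notin r) `|w i|) * `|f|)).
  by rewrite mulr_suml; apply: ler_sum => i _; exact: op_fun_bound.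
rewrite ler_wpM2r//.
have : \sum_(i <- undup (r1 ++ r)) `|w i| <= sup S.
  by apply: ub_le_sup => //; exists (undup (r1 ++ r)).
rewrite (big_subseq _ ur ur2 rr2) (big_subseq _ ur0 ur r0r).
have : 0 <= \sum_(i <- r | i \notin r0) `|w i| by exact: sumr_ge0.
by move: Hr0; lra.
Qed.

End unconditional_sums.
Section complete_subspaces.
Context {R : realType} {I : choiceType}.

(** The limit of the finite partial sums stays in the closed span. *)
Lemma closed_span_complete (V : normedModType R) (S : set V) :
  summable_complete (I := I) V ->
  summable_complete (I := I) (subspace_of (closed_span_pred S)).
Proof.
move=> Vc w c wc; have [s sP] : exists s, has_sum (fun i => \val (w i)) s.
  exact: (Vc _ c).
have sS : s \in closed_span_pred S.
  apply: closed_span_approx => e e0; have [r0 Hr0] := sP e e0.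
  exists (\sum_(i <- undup r0) \val (w i)).
    by rewrite rpred_sum// => i _; exact: valP.
  by rewrite distrC; apply: Hr0; rewrite ?undup_uniq// => i; rewrite mem_undup.
exists (exist (fun v => v \in closed_span_pred S) s sS) => e e0.
have [r0 Hr0] := sP e e0; exists r0 => r ur r0r.
have -> : forall u : subspace_of (closed_span_pred S), `|u| = `|\val u| by [].
by rewrite raddfB raddf_sum; exact: Hr0.
Qed.

End complete_subspaces.

(** * l^1-sums *)

Section l1_theory.
Context {R : realType} {I : choiceType} (V : I -> normedModType R).
Implicit Types (u v : l1_sum V) (r : seq I).

(** Restates the norm by repetition-free sequences, after which infinite sums of
    norms are handled by finite sums only. *)
Lemma sum_normsE (v : families V) :
  sum_norms v = ereal_sup [set (\sum_(i <- r) `|v i|)%:E | r in [set r | uniq r]].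
Proof.
rewrite /sum_norms /esum; congr ereal_sup; apply/seteqP; split=> x [].
  move=> F [finF _] <-; exists (finmap.enum_fset (fset_set F)) => /=.
    exact: finmap.fset_uniq.
  by rewrite fsbig_finite//= sumEFin.
move=> r /= ur <-; exists [set` r]; first by split.
by rewrite -fsbig_seq// sumEFin.
Qed.

Lemma l1_pred_bound (v : families V) (c : R) :
  (forall r, uniq r -> \sum_(i <- r) `|v i| <= c) -> v \in l1_pred V.
Proof.
move=> vc; rewrite unfold_in sum_normsE; apply: (@le_lt_trans _ _ c%:E); last exact: ltry.
by apply: ge_ereal_sup => _ [r /= ur <-]; rewrite lee_fin vc.
Qed.

Lemma l1_normEfin v : `|v|%:E = sum_norms (\val v).
Proof. exact: l1_normE. Qed.

Lemma l1_norm_ge v r : uniq r -> \sum_(i <- r) `|(\val v : families V) i| <= `|v|.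
Proof.
move=> ur; rewrite -lee_fin l1_normEfin sum_normsE.
by apply: ereal_sup_ubound; exists r.
Qed.

Lemma l1_norm_bound v (c : R) :
  (forall r, uniq r -> \sum_(i <- r) `|(\val v : families V) i| <= c) -> `|v| <= c.
Proof.
move=> vc; rewrite -lee_fin l1_normEfin sum_normsE.
by apply: ge_ereal_sup => _ [r /= ur <-]; rewrite lee_fin vc.
Qed.

Lemma l1_intro (Z : normedModType R) (T : forall i, operators Z (V i)) (K : R) :
  (forall r z, uniq r -> \sum_(i <- r) `|T i z| <= K * `|z|) ->
  exists J : operators Z (l1_sum V),
    forall z i, (\val (J z) : families V) i = T i z.
Proof.
move=> TK; pose F z : families V := fun i => T i z.
have Fl1 z : F z \in l1_pred V by apply: (@l1_pred_bound _ (K * `|z|)) => r; exact: TK.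
pose J z : l1_sum V := exist (fun w => w \in l1_pred V) (F z) (Fl1 z).
have Jlin : linear J.
  move=> a u v; apply: val_inj; apply: functional_extensionality_dep => i.
  by rewrite linearP/= /F opP.
have Jbd : op_bound J K by move=> z; apply: l1_norm_bound => r; exact: TK.
by exists (mk_op (conj Jlin (ex_intro _ K Jbd))).
Qed.

(** The universal property of the l^1-sum as a coproduct; the sum defining [P v]
    converges because the norms of its terms add up to at most [M * `|v|]. *)
Lemma l1_elim (W : normedModType R) (T : forall i, operators (V i) W) (M : R) :
  summable_complete (I := I) W -> 0 <= M -> (forall i, `|T i| <= M) ->
  exists P : operators (l1_sum V) W,
    forall v, has_sum (fun i => T i ((\val v : families V) i)) (P v).
Proof.
move=> Wc M0 TM.
have bd v r : uniq r ->
    \sum_(i <- r) `|T i ((\val v : families V) i)| <= M * `|v|.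
  move=> ur; apply: le_trans (ler_wpM2l M0 (l1_norm_ge v ur)).
  rewrite mulr_sumr; apply: ler_sum => i _.
  by rewrite (le_trans (op_fun_bound _ _))// ler_wpM2r.
have /choice[P PP] v : exists s, has_sum (fun i => T i ((\val v : families V) i)) s.
  by apply: (Wc _ (M * `|v|)) => r; exact: bd.
have Plin : linear P.
  move=> a u v; apply: (has_sum_unique (PP _)).
  have := has_sum_lin a (PP u) (PP v).
  by congr has_sum; apply/funext => i; rewrite linearP/= -opP.
have Pbd : op_bound P M.
  move=> v; apply: (has_sum_bound (PP v)) => r ur.
  by rewrite (le_trans (ler_norm_sum _ _ _))// bd.
by exists (mk_op (conj Plin (ex_intro _ M Pbd))).
Qed.

End l1_theory.

Section l1_pair_theory.
Context {R : realType} {V W : normedModType R}.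

Definition l1_fst (u : l1_pair V W) : V := (\val u : families _) true.
Definition l1_snd (u : l1_pair V W) : W := (\val u : families _) false.

Lemma l1_pair_intro (Z : normedModType R) (S : operators Z V) (T : operators Z W) :
  exists J : operators Z (l1_pair V W),
    forall z, l1_fst (J z) = S z /\ l1_snd (J z) = T z.
Proof.
pose F b : operators Z (if b then V else W) :=
  match b return operators Z (if b then V else W) with true => S | false => T end.
have [|J JP] := @l1_intro R bool (fun b : bool => if b then V else W) Z F (`|S| + `|T|).
  move=> r z ur; rewrite mulrDl.
  apply: (@le_trans _ _ (\sum_(b <- [:: true; false]) `|F b z|)).
    rewrite [leRHS](big_subseq _ ur)//; last by case; rewrite !inE.
    by rewrite lerDl sumr_ge0.
  rewrite big_cons big_seq1/= lerD//; exact: op_fun_bound.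
by exists J => z; split; rewrite /l1_fst /l1_snd JP.
Qed.

Lemma l1_pair_elim (Z : normedModType R) (S : operators V Z) (T : operators W Z) :
  exists P : operators (l1_pair V W) Z,
    forall u, P u = S (l1_fst u) + T (l1_snd u).
Proof.
pose P u := S (l1_fst u) + T (l1_snd u).
have Plin : linear P.
  move=> a u v; rewrite /P /l1_fst /l1_snd.
  rewrite (_ : \val (a *: u + v) = a *: \val u + \val v); last exact: linearP.
  by rewrite [in LHS]/=(opP S) (opP T) scalerDr addrACA.
have Pbd : op_bound P (`|S| + `|T|).
  move=> u; have := @l1_norm_ge _ _ _ u [:: true; false] isT.
  rewrite big_cons big_seq1 => Hu; rewrite mulrDl (le_trans (ler_normD _ _))//.
  rewrite lerD// (le_trans (op_fun_bound _ _))// ler_wpM2l// (le_trans _ Hu)//.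
    by rewrite lerDl.
  by rewrite lerDr.
by exists (mk_op (conj Plin (ex_intro _ _ Pbd))).
Qed.

End l1_pair_theory.
(** * Free spaces and their universal property *)

Section free_space.
Context {R : realType} {X : metricType R} {x0 : X}.
Implicit Types (m : LF X x0) (f : lip0 x0).

Definition pairing m f : R := op_fun (\val m : dual (lip0 x0)) f.

Definition ev (x : X) : LF X x0 :=
  exist (fun phi => phi \in closed_span_pred (range (@delta R X x0))) (delta x0 x)
    (mem_closed_span (imageT (@delta R X x0) x)).

Lemma pairing_ev x f : pairing (ev x) f = (\val f) x.
Proof. by []. Qed.

Lemma pairingPl a m m' f : pairing (a *: m + m') f = a * pairing m f + pairing m' f.
Proof. exact: (op_evalP a (\val m : dual (lip0 x0)) (\val m')). Qed.

Lemma pairing0l f : pairing 0 f = 0.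
Proof. by have := pairingPl 0 0 0 f; rewrite scale0r addr0 mul0r add0r. Qed.

Lemma pairingBl m m' f : pairing (m - m') f = pairing m f - pairing m' f.
Proof. by rewrite -scaleN1r addrC pairingPl mulN1r addrC. Qed.

Lemma pairingPr m a f f' : pairing m (a *: f + f') = a * pairing m f + pairing m f'.
Proof. exact: opP. Qed.

Lemma pairing_sumr I (r : seq I) (F : I -> lip0 x0) m :
  pairing m (\sum_(i <- r) F i) = \sum_(i <- r) pairing m (F i).
Proof.
elim/big_rec2: _ => [|i x y _ <-]; first exact: op0.
by rewrite -[F i]scale1r pairingPr mul1r scale1r.
Qed.

Lemma pairing_bound m f : `|pairing m f| <= `|m| * `|f|.
Proof. exact: op_fun_bound. Qed.

Lemma eq_pairing m m' : pairing m =1 pairing m' -> m = m'.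
Proof. by move=> mm'; apply/val_inj/op_ext. Qed.

Lemma LF_norm_le m M : 0 <= M -> (forall f, `|pairing m f| <= M * `|f|) -> `|m| <= M.
Proof. by move=> M0 mM; apply: (@le_op_norm _ _ _ (\val m : dual _)). Qed.

(** If no function of norm at most 1 came within [e] of [`|m|], then rescaling
    arbitrary functions would show that [m] has norm at most [`|m| - e]. *)
Lemma LF_norming m (e : R) : 0 < e ->
  exists f, `|f| <= 1 /\ `|m| <= pairing m f + e.
Proof.
move=> e0; apply: contrapT => /forallNP H.
have [m0|m0] := leP `|m| e.
  by apply: (H 0); rewrite normr0 (le_trans m0)// /pairing op0 add0r.
have : `|m| <= `|m| - e.
  apply: LF_norm_le; first by rewrite subr_ge0 ltW.
  move=> f; have [->|f0] := eqVneq f 0; first by rewrite /pairing op0 !normr0 mulr0.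
  have nf : 0 < `|f| by rewrite normr_gt0.
  rewrite -ler_pdivrMr// leNgt; apply/negP => lt.
  pose s : R := Num.sg (pairing m f).
  apply: (H ((s * `|f|^-1) *: f)); split.
    rewrite normrZ normrM normfV normr_id -mulrA mulVf ?gt_eqF// mulr1 /s.
    by rewrite normr_sg; case: (_ != 0).
  rewrite -lerBlDr (le_trans (ltW lt))// -[_ *: f]addr0 pairingPr [pairing m 0]op0.
  by rewrite addr0 [leRHS]mulrAC -normrEsg.
by rewrite lerBrDr gerDl leNgt e0.
Qed.

Lemma lip_le f x y : `|(\val f) x - (\val f) y| <= `|f| * mdist x y.
Proof. exact: lip_normP. Qed.

Lemma lip_norm_bound f (L : R) : 0 <= L ->
  (forall x y, `|(\val f) x - (\val f) y| <= L * mdist x y) -> `|f| <= L.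
Proof. exact: lip_norm_le. Qed.

Lemma ev_dist x y : `|ev x - ev y| <= mdist x y.
Proof.
apply: LF_norm_le; first exact: mdist_ge0.
by move=> f; rewrite pairingBl !pairing_ev mulrC lip_le.
Qed.

Lemma ev_base : ev x0 = 0.
Proof. by apply: eq_pairing => f; rewrite pairing_ev pairing0l lip0_base. Qed.

Lemma LF_complete (I : choiceType) : summable_complete (I := I) (LF X x0).
Proof. exact/closed_span_complete/dual_complete. Qed.

(** Evaluations span a dense subspace of the free space. *)
Lemma eq_LF_op (W : normedModType R) (T T' : operators (LF X x0) W) :
  (forall x, T (ev x) = T' (ev x)) -> forall m, T m = T' m.
Proof.
move=> TT'; apply: eq_on_closed_span => m [x _ xm].
by rewrite (_ : m = ev x)//; exact: val_inj.
Qed.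

End free_space.

Section universal_property.
Context {R : realType} {X Y : metricType R} {x0 : X} {y0 : Y}.
Implicit Types (k : X -> LF Y y0) (T : operators (LF X x0) (LF Y y0)).

(** [h] is the composite of [k] with the functional [f], shifted by a constant so
    as to vanish at [x0]. *)
Definition is_pull k (f : lip0 y0) (h : lip0 x0) :=
  forall x, (\val h) x = pairing (k x - k x0) f.

(** The second clause, which says that [T] is the adjoint of pulling back along
    [k], gives access to [T m] for [m] outside the span of the evaluations. *)
Definition lip_extends T k := (forall x, T (ev x) = k x - k x0) /\
  forall m f h, is_pull k f h -> pairing (T m) f = pairing m h.

Lemma pull_exists k (L : R) f : 0 <= L ->
  (forall x y, `|k x - k y| <= L * mdist x y) ->
  exists h : lip0 x0, is_pull k f h.
Proof.
move=> L0 kL; pose g : X -> R^o := fun x => pairing (k x - k x0) f.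
have gP : g \in lip0_pred x0.
  apply/asboolP; split; first by rewrite /g subrr pairing0l.
  exists (L * `|f|) => x y; rewrite /g -pairingBl opprB addrA subrK.
  by rewrite (le_trans (pairing_bound _ _))// mulrAC ler_wpM2r.
by exists (exist (fun g => g \in lip0_pred x0) g gP).
Qed.

Lemma pull_norm k (L : R) f h : 0 <= L ->
  (forall x y, `|k x - k y| <= L * mdist x y) -> is_pull k f h -> `|h| <= L * `|f|.
Proof.
move=> L0 kL kh; apply: lip_norm_bound; first by rewrite mulr_ge0.
move=> x y; rewrite !kh -pairingBl opprB addrA subrK.
by rewrite (le_trans (pairing_bound _ _))// mulrAC ler_wpM2r.
Qed.

Lemma lip0_eq (f g : lip0 x0) : (forall x, (\val f) x = (\val g) x) -> f = g.
Proof. by move=> fg; apply/val_inj/funext. Qed.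

(** Pulling back along [k] is a bounded operator from [lip0 y0] to [lip0 x0]. Its
    adjoint sends [delta x] to [k x - k x0], hence maps one free space to the
    other. *)
Lemma lip_extension k (L : R) : 0 <= L ->
  (forall x y, `|k x - k y| <= L * mdist x y) ->
  exists2 T, lip_extends T k & `|T| <= L.
Proof.
move=> L0 kL; have /choice[H HP] f := pull_exists f L0 kL.
have Hlin : linear H.
  move=> a f g; apply: lip0_eq => x; rewrite HP pairingPr -!HP.
  by rewrite linearP.
have Hbd : op_bound H L by move=> f; exact: (pull_norm L0 kL).
pose Hop := mk_op (conj Hlin (ex_intro _ L Hbd)).
have /choice[A AP] (m : dual (lip0 x0)) :
  exists m' : dual (lip0 y0), forall f, op_fun m' f = op_fun m (H f).
  by have [m' m'P] := @comp_op _ _ _ _ m Hop; exists m'.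
have Alin : linear A.
  by move=> a m m'; apply: op_ext => f; rewrite op_evalP !AP op_evalP.
have Abd : op_bound A L.
  move=> m; apply: le_op_norm => [|f]; first by rewrite mulr_ge0.
  rewrite AP (le_trans (op_fun_bound _ _))// -mulrA mulrCA.
  by rewrite ler_wpM2l.
pose Aop := mk_op (conj Alin (ex_intro _ L Abd)).
have Aev x : A (delta x0 x) = \val (k x - k x0).
  apply: op_ext => f; rewrite (AP (delta x0 x) f).
  by transitivity ((\val (H f)) x); last rewrite HP.
have [|T TA TL] := @op_on_closed_span _ _ _ Aop (range (@delta R X x0))
    (range (@delta R Y y0)).
  by move=> _ [x _ <-]; rewrite mk_opE Aev; exact: valP.
exists T; last by rewrite (le_trans TL)//; exact: le_op_norm.
split=> [x|m f h kh]; first by apply: val_inj; rewrite TA mk_opE -Aev.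
rewrite {1}/pairing TA mk_opE AP /pairing; congr (op_fun _ _).
by apply: lip0_eq => x; rewrite HP kh.
Qed.

End universal_property.

Section l1_universal_property.
Context {R : realType} {X : metricType R} {x0 : X}.

(** The components are obtained from [lip_extension]; what remains is to bound
    the sum of the norms of [T i m] over a finite set of indices. Choose for each
    index a function [f i] of norm at most 1 on which [T i m] almost attains its
    norm. Adding up the pullbacks [h i] of these functions gives one function of
    Lipschitz constant at most [K], and [m] evaluated at it is, up to an
    arbitrarily small error, the sum to be bounded. *)
Lemma l1_lip_extension (I : choiceType) (Y : I -> metricType R) (y0 : forall i, Y i)
    (k : forall i, X -> LF (Y i) (y0 i)) (K : R) : 0 <= K ->
  (forall r : seq I, uniq r -> forall x y,
     \sum_(i <- r) `|k i x - k i y| <= K * mdist x y) ->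
  exists J : operators (LF X x0) (l1_sum (fun i => LF (Y i) (y0 i))),
    forall x i, (\val (J (ev x)) : families _) i = k i x - k i x0.
Proof.
move=> K0 kK.
have kL i x y : `|k i x - k i y| <= K * mdist x y.
  by have := kK [:: i] isT x y; rewrite big_seq1.
have [T TP] : exists T : forall i, operators (LF X x0) (LF (Y i) (y0 i)),
    forall i, lip_extends (T i) (k i).
  have H i : exists T : operators (LF X x0) (LF (Y i) (y0 i)), lip_extends T (k i).
    by have [T TP _] := @lip_extension _ _ _ x0 _ _ _ K0 (kL i); exists T.
  by exists (fun i => projT1 (cid (H i))) => i; case: cid.
have [|J JP] := @l1_intro _ _ _ _ T K; last first.
  by exists J => x i; rewrite JP; case: (TP i).
move=> r m ur; apply/ler_addgt0Pr => e e0.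
(* An error of [e / n] per index adds up to less than [e]. *)
pose n : R := (size r)%:R + 1.
have n0 : 0 < n by rewrite ltr_wpDl.
have e1 : 0 < e / n by rewrite divr_gt0.
pose f i := projT1 (cid (LF_norming (T i m) e1)).
have f1 i : `|f i| <= 1 by rewrite /f; case: cid => ? [].
have fT i : `|T i m| <= pairing (T i m) (f i) + e / n.
  by rewrite /f; case: cid => ? [].
pose h i := projT1 (cid (pull_exists (x0 := x0) (f i) K0 (kL i))).
have hP i : is_pull (k i) (f i) (h i) by rewrite /h; case: cid.
have hval x : (\val (\sum_(i <- r) h i)) x = \sum_(i <- r) pairing (k i x - k i x0) (f i).
  rewrite -[LHS](pairing_ev x (\sum_(i <- r) h i)) pairing_sumr.
  by apply: eq_bigr => i _; rewrite pairing_ev hP.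
have hK : `|\sum_(i <- r) h i| <= K.
  apply: lip_norm_bound => // x y; rewrite !hval -sumrB.
  apply: le_trans (kK _ ur x y); apply: (le_trans (ler_norm_sum _ _ _)).
  apply: ler_sum => i _; rewrite -pairingBl opprB addrA subrK.
  by rewrite (le_trans (pairing_bound _ _))// ler_piMr.
apply: (@le_trans _ _ (\sum_(i <- r) (pairing (T i m) (f i) + e / n))).
  by apply: ler_sum => i _; exact: fT.
rewrite big_split/= lerD//.
  under eq_bigr => i _ do rewrite (proj2 (TP i) _ _ _ (hP i)).
  rewrite -pairing_sumr (le_trans (ler_norm _))// (le_trans (pairing_bound _ _))//.
  by rewrite mulrC ler_wpM2r.
rewrite big_const_seq count_predT iter_addr_0 -mulr_natl mulrCA ler_piMr ?(ltW e0)//.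
by rewrite ler_pdivrMr// mul1r /n lerDl.
Qed.

End l1_universal_property.
(** * Subspaces of a metric space *)

Section subset_inclusion.
Context {R : realType} {X : metricType R} {S : set X}.

(** McShane: the largest [L]-Lipschitz extension is the infimum of the cones
    [f y + L * mdist x y]. *)
Lemma mcshane (f : S -> R) (L : R) (b : S) : 0 <= L ->
  (forall y z : S, `|f y - f z| <= L * mdist (\val y) (\val z)) ->
  exists F : X -> R, (forall y, F (\val y) = f y) /\
    forall x x', `|F x - F x'| <= L * mdist x x'.
Proof.
move=> L0 fL; pose Q (x : X) : set R := range (fun y : S => f y + L * mdist x (\val y)).
have Q0 x : Q x !=set0 by exists (f b + L * mdist x (\val b)); exists b.
have low x y z : f z - L * mdist x (\val z) <= f y + L * mdist x (\val y).
  have /(le_trans (ler_norm _)) := fL z y.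
  have := ler_wpM2l L0 (metric_triangle (\val z) x (\val y)).
  by rewrite mulrDr (metric_sym (\val z) x); lra.
have lbQ x : has_lbound (Q x).
  by exists (f b - L * mdist x (\val b)) => _ [y _ <-].
have step x x' : inf (Q x) - inf (Q x') <= L * mdist x x'.
  rewrite lerBlDl -lerBlDr; apply: lb_le_inf => // _ [y _ <-]; rewrite lerBlDr.
  apply: (@le_trans _ _ (f y + L * mdist x (\val y))).
    by apply: ge_inf => //; exists y.
  by rewrite -addrA lerD2l -mulrDr ler_wpM2l// addrC metric_triangle.
exists (fun x => inf (Q x)); split=> [y|x x']; last first.
  rewrite ler_norml step andbT lerNl opprB metric_sym; exact: step.
apply/le_anti/andP; split.
  apply: ge_inf => //; exists y => //.
  by rewrite mdistxx mulr0 addr0.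
apply: lb_le_inf => // _ [z _ <-].
by have := low (\val y) z y; rewrite mdistxx mulr0 subr0.
Qed.

(** The inclusion is 1-Lipschitz, and McShane extensions show that it does not
    decrease norms: every function on [S] is a restriction of one on [X] with
    the same constant. *)
Lemma LF_inclusion (b : S) (x0 : X) :
  exists I : operators (LF S b) (LF X x0),
    (forall y, I (ev y) = ev (\val y) - ev (\val b)) /\ forall m, `|I m| = `|m|.
Proof.
pose k (y : S) : LF X x0 := ev (\val y).
have k1 (y z : S) : `|k y - k z| <= 1 * mdist y z.
  by rewrite mul1r; exact: ev_dist.
have [I [Iev Ipull] I1] := @lip_extension _ _ _ b _ _ _ ler01 k1.
exists I; split=> // m; apply/le_anti/andP; split.
  by rewrite (le_trans (op_fun_bound _ _))// ler_piMl.
apply: LF_norm_le => // f.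
have [|F [Ff FL]] := @mcshane (\val f) `|f| b _ (lip_le f); first by [].
pose h : X -> R^o := fun x => F x - F x0.
have hL x x' : `|h x - h x'| <= `|f| * mdist x x'.
  by rewrite /h opprB addrA subrK.
have hP : h \in lip0_pred x0.
  by apply/asboolP; split; [rewrite /h subrr|exists `|f|].
pose g : lip0 x0 := exist (fun h => h \in lip0_pred x0) h hP.
have gf : is_pull k g f.
  move=> y; rewrite pairingBl !pairing_ev /= /h !Ff opprB addrA subrK.
  by rewrite lip0_base subr0.
rewrite -(Ipull m g f gf) (le_trans (pairing_bound _ _))// ler_wpM2l//.
exact: lip_norm_bound.
Qed.

End subset_inclusion.

Lemma sum_le_card {R : realType} {I : choiceType} (F : I -> R) (c : R)
    (s r : seq I) : uniq r -> (forall i, i \notin s -> F i = 0) ->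
  (forall i, 0 <= F i <= c) -> \sum_(i <- r) F i <= (size s)%:R * c.
Proof.
move=> ur Fs Fc; have F0 i : 0 <= F i by case/andP: (Fc i).
have -> : \sum_(i <- r) F i = \sum_(i <- r | i \in s) F i.
  by rewrite (bigID (mem s))/= [X in _ + X]big1 ?addr0// => i /Fs.
rewrite -big_filter; apply: (@le_trans _ _ (\sum_(i <- undup s) F i)).
  rewrite [leRHS](@big_subseq _ _ _ [seq i <- r | i \in s])// ?filter_uniq ?undup_uniq//.
    by rewrite lerDl sumr_ge0.
  by move=> i; rewrite mem_filter mem_undup => /andP[].
apply: (@le_trans _ _ (\sum_(i <- undup s) c)).
  by apply: ler_sum => i _; case/andP: (Fc i).
have c0 : 0 <= c \/ s = [::].
  by case: (s) => [|i ?]; [right|left; case/andP: (Fc i) => /le_trans h /h].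
case: c0 => [c0|->]; last by rewrite big_nil mul0r.
rewrite big_const_seq count_predT iter_addr_0 -[leLHS]mulr_natl ler_wpM2r// ler_nat.
exact: size_undup.
Qed.

Lemma sum_widen {W : zmodType} {I : choiceType} (F : I -> W) (r s : seq I) :
  uniq r -> uniq s -> {subset r <= s} -> (forall i, i \notin r -> F i = 0) ->
  \sum_(i <- s) F i = \sum_(i <- r) F i.
Proof.
move=> ur us rs F0; rewrite (big_subseq _ ur us rs) [X in _ + X]big1 ?addr0//.
Qed.

(** * Complemented embedding from a partition of unity *)

Section gluing.
Context {R : realType} {X : metricType R} {A : set X}.
Variables (r L : R) (N : nat) (phi : A -> X -> R) (supp : X -> seq A).
Hypotheses (r0 : 0 <= r) (L0 : 0 <= L).
Hypothesis supp_uniq : forall x, uniq (supp x).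
Hypothesis supp_size : forall x, (size (supp x) <= N)%N.
Hypothesis phi_supp : forall x a, a \notin supp x -> phi a x = 0.
Hypothesis phi_sum : forall x, \sum_(a <- supp x) phi a x = 1.
Hypothesis phi_le1 : forall a x, `|phi a x| <= 1.
Hypothesis phi_near : forall a x, phi a x != 0 -> mdist (\val a) x <= r.
Hypothesis phi_lip : forall a x y, `|phi a x - phi a y| <= L * mdist x y.
Variable x0 : X.

(** The local pieces, taken in [LF X]. *)
Let K (a : A) (x : X) : LF X x0 := phi a x *: (ev x - ev (\val a)).

Let c := 1 + L * r.

Let c0 : 0 <= c. Proof. by rewrite addr_ge0// mulr_ge0. Qed.

Let K_supp a x : a \notin supp x -> K a x = 0.
Proof. by move=> ax; rewrite /K phi_supp// scale0r. Qed.

(** Product rule: [phi_a] is bounded by 1 and [ev x] is 1-Lipschitz, while the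
    variation of [phi_a] is multiplied by [ev y - ev a], of norm at most [r]. *)
Let K_lip1 a x y : phi a y != 0 -> `|K a x - K a y| <= c * mdist x y.
Proof.
move=> ay; have -> : K a x - K a y = phi a x *: (ev x - ev y)
    + (phi a x - phi a y) *: (ev y - ev (\val a)).
  by rewrite /K scalerBl addrA -scalerDr subrKA.
rewrite (le_trans (ler_normD _ _))// !normrZ mulrDl mul1r lerD//.
  by rewrite (le_trans _ (ev_dist (x0 := x0) x y))// ler_piMl.
rewrite mulrAC ler_pM//; apply: le_trans (phi_near ay).
by rewrite (le_trans (ev_dist _ _))// metric_sym.
Qed.

Let K_lip a x y : `|K a x - K a y| <= c * mdist x y.
Proof.
have [ay|/K_lip1//] := eqVneq (phi a y) 0.
have [ax|ax] := eqVneq (phi a x) 0.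
  by rewrite /K ax ay !scale0r subrr normr0 mulr_ge0// mdist_ge0.
by rewrite distrC metric_sym K_lip1.
Qed.

(** Only the indices in the support of [x] or of [y] contribute. *)
Let K_sum (s : seq A) x y : uniq s ->
  \sum_(a <- s) `|K a x - K a y| <= (N + N)%:R * c * mdist x y.
Proof.
move=> us; rewrite -mulrA.
apply: (@le_trans _ _ ((size (supp x ++ supp y))%:R * (c * mdist x y))).
  apply: sum_le_card => // a; last by rewrite normr_ge0 K_lip.
  by rewrite mem_cat negb_or => /andP[ax ay]; rewrite !K_supp// subrr normr0.
rewrite ler_wpM2r ?mulr_ge0 ?mdist_ge0// ler_nat size_cat.
exact: leq_add.
Qed.

Let K_total x : \sum_(a <- supp x) K a x =
  ev x - \sum_(a <- supp x) phi a x *: ev (\val a).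
Proof.
under eq_bigr => a _ do rewrite /K scalerBr.
by rewrite sumrB -scaler_suml phi_sum scale1r.
Qed.

Let K_common x y :
  \sum_(a <- undup (supp x ++ supp y)) (K a x - K a y) =
  \sum_(a <- supp x) K a x - \sum_(a <- supp y) K a y.
Proof.
rewrite sumrB; congr (_ - _); apply: sum_widen; rewrite ?undup_uniq//.
- by move=> a ax; rewrite mem_undup mem_cat ax.
- by move=> a; exact: K_supp.
- by move=> a ay; rewrite mem_undup mem_cat ay orbT.
- by move=> a; exact: K_supp.
Qed.

(** [J] has as components the maps [k a], which are the [K a] seen in the free
    spaces of the balls, and [E], the [phi]-average of the evaluations at points
    of [A]. Mapped back to [LF X], they add up to [ev x] because [phi] sums to 1. *)
Lemma partition_of_unity_complemented (a0 : A) (b : forall a : A, cball (\val a) r) :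
  exists U : submodClosed
      (l1_pair (l1_sum (fun a : A => LF (cball (\val a) r) (b a))) (LF A a0)),
    complemented U /\ isomorphic (LF X x0) (subspace_of U).
Proof.
have [IA [IAev IAn]] := LF_inclusion a0 x0.
pose I a := projT1 (cid (LF_inclusion (b a) x0)).
have Iev a y : I a (ev y) = ev (\val y) - ev (\val (b a)).
  by rewrite /I; case: cid => ? [].
have In a m : `|I a m| = `|m| by rewrite /I; case: cid => ? [].
have center (a : A) : cball (\val a) r (\val a) by rewrite /cball/= mdistxx.
pose pt (a : A) x (h : cball (\val a) r x) : cball (\val a) r :=
  SigSub (mem_set h).
pose k (a : A) x : LF (cball (\val a) r) (b a) :=
  match pselect (cball (\val a) r x) with
  | left h => phi a x *: (ev (pt a x h) - ev (pt a _ (center a)))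
  | right _ => 0
  end.
have Ik a x : I a (k a x) = K a x.
  rewrite /k; case: pselect => [h|h]; last first.
    rewrite op0 /K; have [->|/phi_near//] := eqVneq (phi a x) 0.
    by rewrite scale0r.
  rewrite opZ opB !Iev /=.
  by rewrite opprB addrA subrK.
have kn a x y : `|k a x - k a y| = `|K a x - K a y| by rewrite -In opB !Ik.
pose C := (N + N)%:R * c.
have C0 : 0 <= C by rewrite mulr_ge0.
have [|J1 J1ev] := @l1_lip_extension _ _ x0 _ _ b k C C0.
  by move=> s us x y; under eq_bigr => a _ do rewrite kn; exact: K_sum.
pose E x : LF A a0 := \sum_(a <- supp x) phi a x *: ev a.
have IE x : IA (E x) = ev x - \sum_(a <- supp x) K a x - ev (\val a0).
  rewrite K_total opprB (addrC (ev x)) subrK op_sum.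
  under eq_bigr => a _ do rewrite opZ IAev scalerBr.
  by rewrite sumrB -scaler_suml phi_sum scale1r.
(* [IA] is isometric, so [E] may be estimated in [LF X], where it is, up to a
   constant, [ev x] minus the sum of the pieces. *)
have EL x y : `|E x - E y| <= (1 + C) * mdist x y.
  rewrite -IAn opB !IE opprB subrKA opprD addrACA -opprD -K_common.
  rewrite (le_trans (ler_normB _ _))// mulrDl mul1r lerD//; first exact: ev_dist.
  rewrite (le_trans (ler_norm_sum _ _ _))//; apply: K_sum.
  exact: undup_uniq.
have [|J2 [J2ev _] _] := @lip_extension _ _ _ x0 _ _ _ _ EL; first by rewrite addr_ge0.
have [J JP] := l1_pair_intro J1 J2.
have [|P1 P1P] := @l1_elim _ _ _ _ I 1 (@LF_complete _ _ _ _) ler01.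
  by move=> a; apply: le_op_norm => // m; rewrite In mul1r.
have [P PP] := l1_pair_elim P1 IA.
apply: (@retract_complemented _ _ _ J P) => m.
have [PJ PJE] := comp_op P J.
have idlin : linear (@id (LF X x0)) by [].
have idbd : op_bound (@id (LF X x0)) 1 by move=> u; rewrite mul1r.
rewrite -PJE -[RHS]/(mk_op (conj idlin (ex_intro _ 1 idbd)) m).
apply: eq_LF_op => x {m}; rewrite PJE PP (proj1 (JP _)) (proj2 (JP _)) J2ev mk_opE.
(* Only finitely many components of [J1 (ev x)] are nonzero. *)
have -> : P1 (J1 (ev x)) = \sum_(a <- supp x) K a x - \sum_(a <- supp x0) K a x0.
  apply: (has_sum_unique (P1P _)); rewrite -K_common.
  have -> : (fun a => I a ((\val (J1 (ev x)) : families _) a)) =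
      (fun a => K a x - K a x0).
    by apply/funext => a; rewrite J1ev opB !Ik.
  apply: has_sum_finite => [|a]; first exact: undup_uniq.
  rewrite mem_undup mem_cat negb_or => /andP[ax ax0].
  by rewrite !K_supp// subrr.
rewrite opB !IE ev_base sub0r opprB subrKA opprK [LHS]addrC addrACA.
by rewrite subrK subrr addr0.
Qed.

End gluing.
(** * Partitions of unity from maps with finite local range *)

Section partition_of_unity.
Context {R : realType} {X : metricType R} {I : choiceType}.
Variables (rho : X -> I) (h : R) (near : X -> seq I) (N : nat).
Hypotheses (h0 : 0 < h) (near_size : forall x, (size (near x) <= N)%N).
Hypothesis near_rho : forall x y, mdist x y < h -> rho y \in near x.

Let supp x := undup (near x).

(** The bump [psi i] is the supremum of the tents of height [h] and slope 1 over
    the fibre of [rho] at [i]; the value 0 truncates it and makes the set nonempty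
    when the fibre is empty. *)
Let heights i x : set R := 0 |` [set h - mdist x y | y in rho @^-1` [set i]].

Let psi i x : R := sup (heights i x).

Let heights_ub i x : ubound (heights i x) h.
Proof. by move=> _ [->|[y _ <-]]; [exact: ltW|rewrite gerBl mdist_ge0]. Qed.

Let heights_has_ub i x : has_ubound (heights i x).
Proof. by exists h; exact: heights_ub. Qed.

Let psi_ge0 i x : 0 <= psi i x.
Proof. by apply: ub_le_sup; [exact: heights_has_ub|left]. Qed.

Let psi_le i x : psi i x <= h.
Proof. by apply: ge_sup; [exists 0; left|exact: heights_ub]. Qed.

Let psi_rho x : h <= psi (rho x) x.
Proof.
apply: ub_le_sup; first exact: heights_has_ub.
by right; exists x => //; rewrite mdistxx subr0.
Qed.

Let psi_neq0 i x : psi i x != 0 -> exists2 y, rho y = i & mdist x y < h.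
Proof.
move=> p0; apply: contrapT => /forall2NP H; move/negP: p0; apply.
rewrite eq_le psi_ge0 andbT; apply: ge_sup; first by exists 0; left.
move=> _ [->//|[y yi <-]]; rewrite subr_le0 leNgt; apply/negP => yh.
by have [] := H y.
Qed.

Let psi_supp x i : i \notin supp x -> psi i x = 0.
Proof.
rewrite mem_undup => ix; apply/eqP; apply: contraNT ix.
by move=> /psi_neq0[y <- xy]; exact: near_rho.
Qed.

Let psi_step i x y : psi i x - psi i y <= mdist x y.
Proof.
rewrite lerBlDr; apply: ge_sup; first by exists 0; left.
move=> _ [->|[z zi <-]]; first by rewrite addr_ge0// mdist_ge0.
have : h - mdist y z <= psi i y.
  by apply: ub_le_sup; [exact: heights_has_ub|right; exists z].
by have := metric_triangle y x z; rewrite (metric_sym y x); lra.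
Qed.

Let psi_lip i x y : `|psi i x - psi i y| <= mdist x y.
Proof. by rewrite ler_norml psi_step andbT lerNl opprB metric_sym psi_step. Qed.

Let sigma x := \sum_(i <- supp x) psi i x.

(** The tent at [x] itself contributes [h]. *)
Let sigma_ge x : h <= sigma x.
Proof.
have rx : rho x \in supp x by rewrite mem_undup near_rho// mdistxx.
rewrite /sigma (bigD1_seq (rho x))//= ?undup_uniq// -[h]addr0 lerD ?psi_rho//.
exact: sumr_ge0.
Qed.

Let sigma_lip x y : `|sigma x - sigma y| <= (N + N)%:R * mdist x y.
Proof.
pose s := undup (supp x ++ supp y).
have sE z : {subset supp z <= s} -> sigma z = \sum_(i <- s) psi i z.
  move=> zs; apply/esym/sum_widen => //; rewrite ?undup_uniq//.
  by move=> i; exact: psi_supp.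
rewrite !sE -?sumrB; first last.
- by move=> i ix; rewrite mem_undup mem_cat ix.
- by move=> i iy; rewrite mem_undup mem_cat iy orbT.
rewrite (le_trans (ler_norm_sum _ _ _))//.
apply: (@le_trans _ _ ((size (supp x ++ supp y))%:R * mdist x y)).
  apply: sum_le_card; rewrite ?undup_uniq// => i; last by rewrite normr_ge0 psi_lip.
  rewrite mem_cat negb_or => /andP[ix iy].
  by rewrite !psi_supp// subrr normr0.
rewrite ler_wpM2r ?mdist_ge0// ler_nat size_cat.
by apply: leq_add; exact: leq_trans (size_undup _) (near_size _).
Qed.

Let phi i x := psi i x / sigma x.

Let sigma_gt0 x : 0 < sigma x. Proof. exact: lt_le_trans (sigma_ge x). Qed.

Let phi_ge0 i x : 0 <= phi i x.
Proof. by rewrite divr_ge0// ltW. Qed.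

Let phi_le1 i x : phi i x <= 1.
Proof. by rewrite ler_pdivrMr// mul1r (le_trans (psi_le _ _)). Qed.

(** Quotient rule, arranged with the single denominator [sigma x >= h]: the
    variation of [sigma] is then multiplied by [phi i y], which is at most 1. *)
Let phi_lip i x y : `|phi i x - phi i y| <= (1 + (N + N)%:R) / h * mdist x y.
Proof.
have -> : phi i x - phi i y =
    ((psi i x - psi i y) + phi i y * (sigma y - sigma x)) / sigma x.
  rewrite /phi; field.
  by rewrite !gt_eqF.
rewrite normrM normfV (gtr0_norm (sigma_gt0 x)) [leRHS]mulrAC.
apply: ler_pM => //; rewrite ?invr_ge0 ?lef_pV2 ?posrE// ?(ltW (sigma_gt0 x))//.
rewrite mulrDl mul1r; apply: (le_trans (ler_normD _ _)); apply: lerD => //.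
rewrite normrM distrC; apply: le_trans (sigma_lip x y).
by rewrite ler_piMl// ger0_norm.
Qed.

Lemma partition_of_unity : exists (phi : I -> X -> R) (supp : X -> seq I),
  [/\ (forall x, uniq (supp x)), (forall x, (size (supp x) <= N)%N),
      (forall x i, i \notin supp x -> phi i x = 0) &
      (forall x, \sum_(i <- supp x) phi i x = 1)] /\
  [/\ (forall i x, `|phi i x| <= 1),
      (forall i x, phi i x != 0 -> exists2 y, rho y = i & mdist x y < h) &
      (forall i x y, `|phi i x - phi i y| <= (1 + (N + N)%:R) / h * mdist x y)].
Proof.
exists phi, supp; split; split.
- by move=> x; exact: undup_uniq.
- by move=> x; exact: leq_trans (size_undup _) (near_size _).
- by move=> x i ix; rewrite /phi psi_supp// mul0r.
- by move=> x; rewrite -mulr_suml; apply: mulfV; exact: lt0r_neq0 (sigma_gt0 x).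
- by move=> i x; rewrite ger0_norm.
- by move=> i x; rewrite mulf_eq0 negb_or => /andP[/psi_neq0].
- exact: phi_lip.
Qed.

End partition_of_unity.

(** * The map to a maximal separated set *)

Section nagata_retraction.
Context {R : realType} {X : metricType R}.

(** Otherwise [z] could be added to [A]. *)
Lemma maximal_separated_near (s : R) (A : set X) (z : X) : 0 < s ->
  maximal_separated s A -> exists a : A, mdist (\val a) z <= s.
Proof.
move=> s0 [sepA maxA]; apply: contrapT => /forallNP far; apply: maxA.
have {}far a : A a -> s < mdist a z.
  move=> Aa; rewrite ltNge; apply/negP => az.
  by apply: (far (SigSub (mem_set Aa))).
exists (z |` A).
  move=> a b [->|Aa] [->|Ab]// ab; last exact: sepA.
  - by rewrite metric_sym far.
  - exact: far.
split; first by move=> a Aa; right.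
move=> /(_ z (or_introl erefl)) /far; rewrite mdistxx => /(lt_trans s0).
by rewrite ltxx.
Qed.

(** Send [x] to a point of [A] near a chosen point of a chosen member of the cover
    that contains [x]. A ball of radius [s / 2] has diameter at most [s], so it
    meets few members of the cover, and [rho] takes few values on it. *)
Lemma nagata_retraction (n : nat) (gamma s : R) (A : set X) :
  nagata_dim X n gamma -> 0 < s -> maximal_separated s A -> A !=set0 ->
  exists (rho : X -> A) (near : X -> seq A),
    [/\ (forall x, mdist (\val (rho x)) x <= (`|gamma| + 1) * s),
        (forall x, (size (near x) <= n.+1)%N) &
        (forall x y, mdist x y < s / 2 -> rho y \in near x)].
Proof.
move=> nag s0 maxA [z0 _]; have [C [Ccov Cdiam Cmult]] := nag s s0.
have /choice[p pP] z : exists a : A, mdist (\val a) z <= s.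
  exact: maximal_separated_near.
have /choice[z zP] (c : set X) : exists z, c !=set0 -> c z.
  by have [[z cz]|c0] := pselect (c !=set0); [exists z|exists z0].
have /choice[c cP] x : exists c, C c /\ c x.
  have : (\bigcup_(c in C) c) x by rewrite Ccov.
  by move=> [c Cc cx]; exists c.
pose meets x : set (set X) := [set d | C d /\ d `&` [set y | mdist x y < s / 2] !=set0].
have meets_card x : (meets x #<= `I_n.+1)%card.
  apply: Cmult; apply: ge_ereal_sup => _ [y xy [w xw <-]]; rewrite lee_fin.
  have := metric_triangle y x w; rewrite (metric_sym y x).
  by move: xy xw => /=; lra.
have meets_fin x : finite_set (meets x) by apply/finite_set_leP; exists n.+1.
exists (fun x => p (z (c x))),
  (fun x => [seq p (z d) | d <- finmap.enum_fset (fset_set (meets x))]).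
split=> [x|x|x y xy].
- have [Cc cx] := cP x; have cz : c x (z (c x)) by apply: zP; exists x.
  have xz : mdist (z (c x)) x <= `|gamma| * s.
    apply: le_trans (_ : gamma * s <= _); last by rewrite ler_wpM2r ?ler_norm// ltW.
    rewrite -lee_fin; apply: le_trans (Cdiam _ Cc); apply: ereal_sup_ubound.
    by exists (z (c x)) => //; exists x.
  have := metric_triangle (\val (p (z (c x)))) (z (c x)) x.
  by have := pP (z (c x)); rewrite mulrDl mul1r; lra.
- by rewrite size_map; exact: geq_card_fset_set.
- apply: map_f; have [Cc cy] := cP y.
  by rewrite in_fset_set// inE; split=> //; exists y.
Qed.

End nagata_retraction.

Theorem lemma6p2 (R : realType) (X : metricType R) (hX : finite_nagata_dim X) :
  exists lambda : R, 0 <= lambda /\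
    forall (s : R) (A : set X), 0 < s -> maximal_separated s A ->
    forall (x0 : X) (a0 : A)
      (b : forall a : A, cball (\val a) (lambda * s)),
    exists U : submodClosed
        (l1_pair (l1_sum (fun a : A => LF (cball (\val a) (lambda * s)) (b a)))
                 (LF A a0)),
      complemented U /\ isomorphic (LF X x0) (subspace_of U).
Proof.
have [n [gamma nag]] := hX.
(* If [phi_a x] is nonzero then [x] is within [s / 2] of some [y] with
   [rho y = a], and [y] is within [(`|gamma| + 1) * s] of [a]. *)
exists (`|gamma| + 2); split; first by rewrite addr_ge0.
move=> s A s0 maxA x0 a0 b.
have A0 : A !=set0 by exists (\val a0); exact/set_mem/(valP a0).
have [rho [near [rho_near near_size near_rho]]] := nagata_retraction nag s0 maxA A0.
have h0 : 0 < s / 2 by rewrite divr_gt0.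
have [phi [supp [[su ss phi_supp phi_sum] [phi1 phi_near phi_lip]]]] :=
  partition_of_unity h0 near_size near_rho.
apply: (partition_of_unity_complemented _ _ su ss phi_supp phi_sum phi1 _ phi_lip).
- by rewrite mulr_ge0 ?addr_ge0// ltW.
- by rewrite divr_ge0 ?addr_ge0// ltW.
- move=> a x /phi_near[y <- xy]; have := metric_triangle (\val (rho y)) y x.
  have := rho_near y; rewrite (metric_sym y x).
  by rewrite !mulrDl; lra.
Qed.
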